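(* Assume the degree-associated reconstruction conjecture for digraphs is true. Then for all finite digraphs $G$ and $H$ with $G\not\cong H$, player $\forall$ has a winning strategy in the Seurat game $\mathbf{G}^3(G,H)$ (the game with $3$ colours).
   Context: A digraph is a finite set of vertices $V$ with an edge relation $E\subseteq V\times V$ (loops allowed, no multiple edges); a digraph is identified with its vertex set. For a vertex $v$, $\mathsf{in}(v)=|E\cap(V\times\{v\})|$, $\mathsf{out}(v)=|E\cap(\{v\}\times V)|$, and $\tau(v)=(\mathsf{in}(v),\mathsf{out}(v))$. For a vertex $u$ of $G$, $G\setminus\{u\}$ denotes the induced subdigraph on the remaining vertices. Degree-associated reconstruction conjecture for digraphs: if $G$ and $H$ are non-isomorphic digraphs, at least one of which has at least three vertices, then there exist a pair $(x,y)\in\omega\times\omega$ and a digraph $F$ such that, with $S=\{u\in G:\tau(u)=(x,y)\text{ and }G\setminus\{u\}\cong F\}$ and $T=\{v\in H:\tau(v)=(x,y)\text{ and }H\setminus\{v\}\cong F\}$, we have $|S|\neq|T|$. Seurat game $\mathbf{G}^k(G,H)$: two players $\forall$ and $\exists$, a set $\mathbf{Col}$ of $k$ colours. A position is a pair of functions $g:\mathbf{Col}\to\wp(G)$, $h:\mathbf{Col}\to\wp(H)$; initially every colour is assigned the empty set. There are $\omega$ rounds. In each round $\forall$ chooses a colour $c$, one of the two graphs, and a subset of its vertices; then $\exists$ chooses a subset of the vertices of the other graph; the new position agrees with the old one except that $c$ is now assigned the two chosen sets (in their respective graphs), erasing its previous use. The palette of a vertex is the set of colours whose assigned set contains it; for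 $P\subseteq\mathbf{Col}$, $P^G$ (resp. $P^H$) is the set of vertices of $G$ (resp. $H$) whose palette is exactly $P$. $\forall$ wins in round $n$ if at the beginning of that round either (C1) there is a palette $P$ with $P^G$ empty and $P^H$ nonempty or vice versa, or (C2) there are palettes $P_1,P_2$ such that there is an edge from a vertex of $P_1^G$ to a vertex of $P_2^G$ but no edge from $P_1^H$ to $P_2^H$, or vice versa. $\forall$ has a winning strategy if he can guarantee winning in finitely many rounds; $\exists$ has a winning strategy if she can play so that $\forall$ never wins. *)

(* Defs.v *)
From mathcomp Require Import all_boot.

Set Implicit Arguments.
Unset Strict Implicit.
Unset Printing Implicit Defensive.

Record digraph := Digraph { vertex :> finType; edge : rel vertex }.

Section Digraphs.
Implicit Types G H F : digraph.

Definition indeg G (v : G) : nat := #|[set u : G | edge u v]|.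
Definition outdeg G (v : G) : nat := #|[set w : G | edge v w]|.
Definition tau G (v : G) : nat * nat := (indeg v, outdeg v).

Definition del_vertex G (u : G) : digraph :=
  @Digraph {x : G | x != u} (fun x y => edge (val x) (val y)).

(* Boolean, so that it can be used in set comprehensions; see isoP. *)
Definition iso G H : bool :=
  [exists f : {ffun G -> H}, exists g : {ffun H -> G},
    [&& [forall x, g (f x) == x], [forall y, f (g y) == y]
      & [forall x, forall y, edge (f x) (f y) == edge x y]]].

Lemma isoP G H :
  reflect (exists f : G -> H,
             bijective f /\ forall x y, edge (f x) (f y) = edge x y)
          (iso G H).
Proof.
apply: (iffP existsP) => [[f /existsP[g /and3P[gf fg ff]]] | [f [[g gf fg] ff]]].
  exists f; split; last by move=> x y; apply/eqP/(forallP (forallP ff x)).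
  by exists g => x; apply/eqP; [apply: (forallP gf) | apply: (forallP fg)].
exists (finfun f); apply/existsP; exists (finfun g).
apply/and3P; split; apply/forallP => x; rewrite ?ffunE ?gf ?fg //.
by apply/forallP => y; rewrite !ffunE ff.
Qed.

Definition deleted G (xy : nat * nat) F : {set G} :=
  [set u : G | (tau u == xy) && iso (del_vertex u) F].

Definition degree_associated_reconstruction : Prop :=
  forall G H, ~~ iso G H -> 3 <= #|G| \/ 3 <= #|H| ->
  exists (xy : nat * nat) F, #|deleted G xy F| <> #|deleted H xy F|.

End Digraphs.

Section SeuratGame.
Variables (k : nat) (G H : digraph).

Definition colouring (K : digraph) := {ffun 'I_k -> {set K}}.

Definition palette (K : digraph) (g : colouring K) (v : K) : {set 'I_k} :=
  [set c | v \in g c].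

Definition palette_class (K : digraph) (g : colouring K) (P : {set 'I_k}) :
    {set K} :=
  [set v | palette g v == P].

Definition has_edge (K : digraph) (A B : {set K}) : bool :=
  [exists u in A, exists v in B, edge u v].

Definition recolour (K : digraph) (g : colouring K) (c : 'I_k) (A : {set K}) :
    colouring K :=
  [ffun d => if d == c then A else g d].

Definition position := (colouring G * colouring H)%type.

Definition initial_position : position := ([ffun=> set0], [ffun=> set0]).

Definition cond1 (p : position) : Prop :=
  exists P : {set 'I_k},
    (palette_class p.1 P == set0) != (palette_class p.2 P == set0).

Definition cond2 (p : position) : Prop :=
  exists P1 P2 : {set 'I_k},
    has_edge (palette_class p.1 P1) (palette_class p.1 P2)
    != has_edge (palette_class p.2 P1) (palette_class p.2 P2).

Definition won (p : position) : Prop := cond1 p \/ cond2 p.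

Inductive move :=
  | MoveG of 'I_k & {set G}
  | MoveH of 'I_k & {set H}.

(* The move [m] is made by the player "forall"; the existential quantifier is
   the free choice of the player "exists" in the other graph. *)
Definition round (p : position) (m : move) (q : position) : Prop :=
  match m with
  | MoveG c A => exists B, q = (recolour p.1 c A, recolour p.2 c B)
  | MoveH c B => exists A, q = (recolour p.1 c A, recolour p.2 c B)
  end.

(* A strategy may depend on all positions so far, the current one last. *)
Definition strategy := seq position -> move.

(* Plays go on for omega rounds, also after a won position; [q n] is the
   position at the beginning of round [n]. *)
Definition play (s : strategy) (q : nat -> position) : Prop :=
  q 0 = initial_position /\
  forall n, round (q n) (s (mkseq q n.+1)) (q n.+1).

Definition forall_has_winning_strategy : Prop :=
  exists s : strategy, forall q, play s q -> exists n, won (q n).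

End SeuratGame.

(* Main.v *)
Require Import Defs.
From mathcomp Require Import all_boot.

(* Two colours suffice to win when one of them has different cardinalities in
   the two graphs: give the other colour to a proper subset of the larger set,
   of the size of the smaller one; the reply must be a proper subset of the
   smaller set, so the imbalance persists at a smaller size and the first
   colour is free again.

   Hence let a colour [a] mark nonisomorphic induced subgraphs X, Y of equal
   size.  If the reconstruction conjecture gives a card occurring more often
   in X than in Y, colour the vertices S of X with that card; the reply has
   as many elements, so it contains a vertex v without that card.  Colour v;
   the reply is a single u in S.  If the degrees of u and v differ, colour the
   larger neighbourhood and then, in the reply, a vertex that is not a
   neighbour.  Otherwise X \ u and Y \ v are not isomorphic; mark them with
   the colour of S, which frees [a], and induct.  Once at most two vertices
   are left, colouring one of them makes all palettes distinct. *)

Set Implicit Arguments.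
Unset Strict Implicit.
Unset Printing Implicit Defensive.

(** * Isomorphisms and induced subdigraphs *)

Lemma iso_sym G H : iso G H -> iso H G.
Proof.
case/isoP => f [[g gK fK] fE]; apply/isoP; exists g; split; first by exists f.
by move=> x y; rewrite -fE !fK.
Qed.

Lemma iso_trans G H K : iso G H -> iso H K -> iso G K.
Proof.
case/isoP => f [f_bij fE] /isoP[g [g_bij gE]]; apply/isoP; exists (g \o f).
by split=> [|x y]; [apply: bij_comp | rewrite /= gE fE].
Qed.

(** Indexed by a set of vertices of a fixed [G], so that the induction can shrink a colour class and
    keep the same graph. *)
Definition induced (G : digraph) (X : {set G}) : digraph :=
  @Digraph {x : G | x \in X} (fun x y => edge (val x) (val y)).

Lemma iso_induced_setT G : iso G (induced [set: G]).
Proof.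
apply/isoP; exists (fun x : G => Sub x (in_setT x) : induced [set: G]).
by split=> //; exists val => // x; apply: val_inj.
Qed.

(** Flattens a subtype of a subtype: cards of [induced X] become colour classes of [G]. *)
Lemma del_vertex_induced (G : digraph) (X : {set G}) (u : induced X) :
  iso (del_vertex u) (induced (X :\ val u)).
Proof.
have fP (x : del_vertex u) : val (val x) \in X :\ val u.
  by rewrite !inE (valP x) (valP (val x)).
have gX (x : induced (X :\ val u)) : val x \in X by have /setD1P[] := valP x.
have gP (x : induced (X :\ val u)) : (Sub (val x) (gX x) : induced X) != u.
  by have /setD1P[] := valP x.
apply/isoP; exists (fun x => Sub (val (val x)) (fP x)); split=> //.
exists (fun x => Sub (Sub (val x) (gX x) : induced X) (gP x) : del_vertex u).
  by move=> x; do 2 apply: val_inj.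
by move=> x; apply: val_inj.
Qed.

(* The edge relation for [d = true], its converse for [d = false]. *)
Definition adj (G : digraph) (d : bool) (u w : G) : bool :=
  if d then edge u w else edge w u.

Lemma card_induced (G : digraph) (X : {set G}) (P : pred G) :
  #|[set w : induced X | P (val w)]| = #|[set w in X | P w]|.
Proof.
rewrite -(card_imset _ val_inj); apply: eq_card => w; rewrite !inE.
apply/imsetP/andP => [[x + ->] | [wX Pw]]; first by rewrite inE (valP x).
by exists (Sub w wX : induced X); rewrite ?inE.
Qed.

Lemma tau_induced (G : digraph) (X : {set G}) (u : induced X) :
  tau u = (#|[set w in X | adj false (val u) w]|,
           #|[set w in X | adj true (val u) w]|).
Proof. by rewrite -!card_induced. Qed.

Lemma exists_subset_card (T : finType) (A : {set T}) n :
  n <= #|A| -> exists2 B : {set T}, B \subset A & #|B| = n.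
Proof.
elim: n => [|n IHn] leA; first by exists set0; rewrite ?sub0set ?cards0.
have [B sBA cB] := IHn (ltnW leA).
have /properP[_ [x xA xB]] : B \proper A by rewrite properEcard sBA cB.
by exists (x |: B); rewrite ?subUset ?sub1set ?xA // cardsU1 xB cB.
Qed.

(** * Winning positions and strategies *)

Section Game.
Variable k : nat.

(** The well-founded game tree, free of histories; the digraphs are not fixed, so that they can be
    swapped in [win_sym]. *)
Inductive win (G H : digraph) : colouring k G -> colouring k H -> Prop :=
  | win_won g h : won (g, h) -> win g h
  | win_moveG g h c A :
      (forall B, win (recolour g c A) (recolour h c B)) -> win g h
  | win_moveH g h c B :
      (forall A, win (recolour g c A) (recolour h c B)) -> win g h.

Lemma won_sym (G H : digraph) (g : colouring k G) (h : colouring k H) :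
  won (g, h) -> won (h, g).
Proof.
case=> [[P wP] | [P1 [P2 wP]]]; first by left; exists P; rewrite eq_sym.
by right; exists P1, P2; rewrite eq_sym.
Qed.

Lemma win_sym (G H : digraph) (g : colouring k G) (h : colouring k H) :
  win g h -> win h g.
Proof.
elim=> {g h} [g h w | g h c A _ IH | g h c B _ IH].
- by apply: win_won; apply: won_sym.
- exact: win_moveH IH.
- exact: win_moveG IH.
Qed.

Definition wins_from (G H : digraph) (p : position k G H) : Prop :=
  exists s : strategy k G H, forall q,
    q 0 = p -> (forall n, round (q n) (s (mkseq q n.+1)) (q n.+1)) ->
    exists n, won (q n).

Lemma mkseqS T (q : nat -> T) n :
  mkseq q n.+1 = q 0 :: mkseq (fun i => q i.+1) n.
Proof. by rewrite /mkseq /= -(addn0 1) iotaDl -map_comp. Qed.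

(* The reply [r] of the opponent is read off the second position of the
   history, so that only finitely many continuations have to be chosen. *)
Lemma wins_from_step (G H : digraph) (p : position k G H) (m : move k G H)
    (R : finType) (next : R -> position k G H) (reply : position k G H -> R) :
  (forall q, round p m q -> q = next (reply q)) ->
  (forall r, wins_from (next r)) -> wins_from p.
Proof.
move=> mP /fin_all_exists[f fP].
exists (fun h => if h is _ :: p1 :: t then f (reply p1) (p1 :: t) else m).
move=> q q0 qP; have := qP 0; rewrite q0 => /mP q1.
have [|n wn] := fP (reply (q 1)) (fun n => q n.+1) q1; last by exists n.+1.
by move=> n; have := qP n.+1; rewrite !mkseqS.
Qed.

Lemma win_wins_from (G H : digraph) (g : colouring k G) (h : colouring k H) :
  0 < k -> win g h -> wins_from (g, h).
Proof.
move=> k_gt0; elim=> {g h} [g h w | g h c A _ IH | g h c B _ IH].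
(* The start is already won, so any move will do; [k_gt0] provides a colour for it. *)
- exists (fun=> MoveG H (Ordinal k_gt0) set0) => q q0 _.
  by exists 0; rewrite q0.
- apply: (@wins_from_step _ _ _ (MoveG H c A) _ _ (fun p => p.2 c)) IH.
  by move=> _ [B ->] /=; rewrite ffunE eqxx.
- apply: (@wins_from_step _ _ _ (MoveH G c B) _ _ (fun p => p.1 c)) IH.
  by move=> _ [A ->] /=; rewrite ffunE eqxx.
Qed.

Lemma won_dec (G H : digraph) (p : position k G H) : won p \/ ~ won p.
Proof.
have [/existsP w | n1] := boolP [exists P : {set 'I_k},
  (palette_class p.1 P == set0) != (palette_class p.2 P == set0)].
  by left; left.
have [/existsP[P1 /existsP w] | n2] := boolP [exists P1 : {set 'I_k},
  [exists P2 : {set 'I_k},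
    has_edge (palette_class p.1 P1) (palette_class p.1 P2)
    != has_edge (palette_class p.2 P1) (palette_class p.2 P2)]].
  by left; right; exists P1.
right=> -[w | [P1 w]]; first by case/existsP: n1.
by case/existsP: n2; exists P1; apply/existsP.
Qed.

(** * Moves and positions not yet won *)

Definition same_palette (G H : digraph) (g : colouring k G)
    (h : colouring k H) (x : G) (y : H) : Prop :=
  forall c, (x \in g c) = (y \in h c).

Section Move.
Variables (G H : digraph) (g : colouring k G) (h : colouring k H).

(** The reply stays unnamed: all that is used of it follows from the new position not being won. *)
Lemma win_step_l (c : 'I_k) (A : {set G}) :
  (forall (g' : colouring k G) (h' : colouring k H),
     g' c = A ->
     (forall d, d != c -> g' d = g d) ->
     (forall d, d != c -> h' d = h d) -> ~ won (g', h') -> win g' h') ->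
  win g h.
Proof.
move=> IH; apply: (@win_moveG _ _ _ _ c A) => B.
set g' := recolour g c A; set h' := recolour h c B.
have [w | nw] := won_dec (g', h'); first exact: win_won.
by apply: IH => // [|d /negPf dc|d /negPf dc]; rewrite ffunE ?eqxx ?dc.
Qed.

Lemma win_step_r (c : 'I_k) (B : {set H}) :
  (forall (g' : colouring k G) (h' : colouring k H),
     h' c = B ->
     (forall d, d != c -> g' d = g d) ->
     (forall d, d != c -> h' d = h d) -> ~ won (g', h') -> win g' h') ->
  win g h.
Proof.
move=> IH; apply: (@win_moveH _ _ _ _ c B) => A.
set g' := recolour g c A; set h' := recolour h c B.
have [w | nw] := won_dec (g', h'); first exact: win_won.
by apply: IH => // [|d /negPf dc|d /negPf dc]; rewrite ffunE ?eqxx ?dc.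
Qed.

Hypothesis nwon : ~ won (g, h).

Lemma not_won_vertex x : exists y, same_palette g h x y.
Proof.
have [/eqP E | /set0Pn[y]] :=
    boolP (palette_class h (palette g x) == set0).
  case: nwon; left; exists (palette g x); rewrite /= E eqxx eqb_id.
  by apply/set0Pn; exists x; rewrite inE.
rewrite inE => /eqP/setP E; exists y => c.
by have := E c; rewrite !inE.
Qed.

Lemma not_won_edge x x' : edge x x' ->
  exists y y', [/\ same_palette g h x y, same_palette g h x' y' & edge y y'].
Proof.
move=> e.
have [/existsP[y /andP[yP /existsP[y' /andP[y'P e']]]] | E] :=
    boolP (has_edge (palette_class h (palette g x))
                    (palette_class h (palette g x'))).
  exists y, y'; move: yP y'P; rewrite !inE => /eqP/setP E /eqP/setP E'.
  by split=> // c; [have := E c | have := E' c]; rewrite !inE.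
case: nwon; right; exists (palette g x), (palette g x').
rewrite /= (negPf E) eqbF_neg negbK.
apply/existsP; exists x; rewrite inE eqxx /=.
by apply/existsP; exists x'; rewrite inE eqxx.
Qed.

Lemma not_won_adj d x x' : adj d x x' ->
  exists y y', [/\ same_palette g h x y, same_palette g h x' y' & adj d y y'].
Proof.
by case: d => /not_won_edge[y [y' [? ? ?]]]; [exists y, y' | exists y', y].
Qed.

End Move.

Lemma not_won_sym (G H : digraph) (g : colouring k G) (h : colouring k H) :
  ~ won (g, h) -> ~ won (h, g).
Proof. by move=> nw /won_sym. Qed.

(** * Imbalances of cardinality and degree *)

Lemma win_card (G H : digraph) (g : colouring k G) (h : colouring k H)
    (a b : 'I_k) :
  a != b -> #|g a| != #|h a| -> win g h.
Proof.
have [n] := ubnP (#|g a| + #|h a|).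
elim: n => // n IHn in G H g h a b * => lt_n ab ne.
wlog lt_hg : G H g h lt_n ne / #|h a| < #|g a|.
  move=> IH; move: (ne); rewrite neq_ltn => /orP[lt|]; last exact: IH.
  by apply: win_sym; apply: IH; rewrite // 1?addnC // eq_sym.
have [w | nw] := won_dec (g, h); first exact: win_won.
have [y0 y0h] : exists y, y \in h a.
  have /card_gt0P[x xg] : 0 < #|g a| by apply: leq_ltn_trans lt_hg.
  by have [y xy] := not_won_vertex nw x; exists y; rewrite -xy.
have [B sB cB] := exists_subset_card (ltnW lt_hg).
have /properP[_ [x xg xB]] : B \proper g a by rewrite properEcard sB cB.
apply: (@win_step_l _ _ _ _ b B) => g' h' g'b g'E h'E nw'.
(* In [G], [b] lies inside [a] and misses [x]; by (C1) the reply lies inside [h a] and misses a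
   vertex of it. *)
have lt' : #|h' b| < #|g' b|.
  rewrite g'b cB; apply: proper_card; apply/properP; split.
    apply/subsetP=> y yh; have [z yz] := not_won_vertex (not_won_sym nw') y.
    rewrite -h'E // yz g'E //; apply: (subsetP sB).
    by rewrite -g'b -yz.
  have [y xy] := not_won_vertex nw' x; exists y.
    by rewrite -h'E // -xy g'E.
  by rewrite -xy g'b.
(* The colours swap roles; the sum of sizes drops, as [#|g' b| = #|h a|] and [#|h' b| < #|g a|]. *)
apply: (IHn _ _ _ _ b a); rewrite ?gtn_eqF // 1?eq_sym //.
rewrite g'b cB in lt' *; move: lt_n; rewrite ltnS; apply: leq_trans.
by rewrite addnC ltn_add2r (ltn_trans lt').
Qed.

Lemma win_degree (G H : digraph) (g : colouring k G) (h : colouring k H)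
    (a b c : 'I_k) d (u : G) (v : H) :
  a != b -> a != c -> b != c -> g c = [set u] -> h c = [set v] ->
  #|[set w in g a | adj d u w]| != #|[set w in h a | adj d v w]| -> win g h.
Proof.
move=> ab ac bc gc hc ne.
wlog lt : G H g h u v gc hc ne /
    #|[set w in h a | adj d v w]| < #|[set w in g a | adj d u w]|.
  move=> IH; move: (ne); rewrite neq_ltn => /orP[lt|]; last exact: IH.
  by apply: win_sym; apply: (IH _ _ _ _ v u) => //; rewrite eq_sym.
set N := [set w in g a | _] in ne lt.
apply: (@win_step_l _ _ _ _ b N) => g1 h1 g1b g1E h1E nw1.
have [c1|] := eqVneq #|g1 b| #|h1 b|; last first.
  by apply: (@win_card _ _ _ _ b a); rewrite 1?eq_sym.
have sh1 : h1 b \subset h a.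
  apply/subsetP=> y yh; have [z yz] := not_won_vertex (not_won_sym nw1) y.
  rewrite -h1E // yz g1E //.
  by move: yh; rewrite yz g1b inE => /andP[].
(* [h1 b] has as many elements as [N], more than [v] has neighbours in [h a]. *)
have [w' w'h w'n] : exists2 w', w' \in h1 b & ~~ adj d v w'.
  apply/exists_inP; apply: contraTT lt => /exists_inPn nex.
  rewrite -leqNgt -g1b c1; apply: subset_leq_card; apply/subsetP=> y yh.
  by rewrite inE (subsetP sh1) //; have := nex y yh; rewrite negbK.
(* Colour [a] can be given up, since [b] now records the neighbourhood [N]. *)
apply: (@win_step_r _ _ _ _ a [set w']) => g2 h2 h2a g2E h2E nw2.
have [c2|] := eqVneq #|g2 a| #|h2 a|; last exact: (@win_card _ _ _ _ a b).
have [w g2a] : exists w, g2 a = [set w].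
  by apply/cards1P; rewrite c2 h2a cards1.
have ba : b != a by rewrite eq_sym.
have ca : c != a by rewrite eq_sym.
have cb : c != b by rewrite eq_sym.
have wN : w \in N.
  have [z wz] := not_won_vertex nw2 w.
  rewrite -g1b -g2E // wz h2E //.
  by have := wz a; rewrite g2a h2a !inE eqxx => /esym/eqP->.
have uw : adj d u w by move: wN; rewrite inE => /andP[].
(* (C2) carries the adjacency of [u] and [w] to [v] and [w'], the only vertices of [H] coloured [c]
   and [a]. *)
have [y [y' [uy wy']]] := not_won_adj nw2 uw.
have := wy' a; rewrite g2a h2a !inE eqxx => /esym/eqP->.
have := uy c; rewrite g2E // h2E // g1E // h1E // gc hc !inE eqxx.
by move=> /esym/eqP->; rewrite (negPf w'n).
Qed.

(** * Non-isomorphic colour classes *)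

(** (C1) matches vertices of equal palette, injectivity makes this a bijection, and (C2), used in
    both directions, preserves edges. *)
Lemma not_won_iso (G H : digraph) (g : colouring k G) (h : colouring k H)
    (a : 'I_k) :
  ~ won (g, h) ->
  {in g a &, injective (palette g)} -> {in h a &, injective (palette h)} ->
  iso (induced (g a)) (induced (h a)).
Proof.
have same (G1 H1 : digraph) (g1 : colouring k G1) (h1 : colouring k H1) :
    ~ won (g1, h1) -> forall x : induced (g1 a), exists y : induced (h1 a),
    same_palette g1 h1 (val x) (val y).
  move=> nw x; have [y xy] := not_won_vertex nw (val x).
  have yP : y \in h1 a by rewrite -xy (valP x).
  by exists (Sub y yP).
move=> nw ig ih.
have uniqG x x' : x \in g a -> x' \in g a ->
    (forall c, (x \in g c) = (x' \in g c)) -> x = x'.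
  by move=> xa x'a E; apply: ig => //; apply/setP=> c; rewrite !inE.
have uniqH y y' : y \in h a -> y' \in h a ->
    (forall c, (y \in h c) = (y' \in h c)) -> y = y'.
  by move=> ya y'a E; apply: ih => //; apply/setP=> c; rewrite !inE.
have /fin_all_exists[f fP] := same _ _ _ _ nw.
have /fin_all_exists[f' f'P] := same _ _ _ _ (not_won_sym nw).
apply/isoP; exists f; split.
  exists f' => x; apply: val_inj.
    by apply: uniqG (valP _) (valP _) _ => c; rewrite -f'P -fP.
  by apply: uniqH (valP _) (valP _) _ => c; rewrite -fP -f'P.
move=> x x'; apply/idP/idP => e.
  have [y [y' [xy x'y' e']]] := not_won_edge (not_won_sym nw) e.
  have yE : y = val x.
    by apply: uniqG (valP _) _ => [|c]; rewrite -xy ?fP // (valP (f x)).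
  have y'E : y' = val x'.
    by apply: uniqG (valP _) _ => [|c]; rewrite -x'y' ?fP // (valP (f x')).
  by rewrite yE y'E in e'.
have [y [y' [xy x'y' e']]] := not_won_edge nw e.
have yE : y = val (f x).
  by apply: uniqH (valP _) _ => [|c]; rewrite -xy -?fP ?(valP x).
have y'E : y' = val (f x').
  by apply: uniqH (valP _) _ => [|c]; rewrite -x'y' -?fP ?(valP x').
by rewrite yE y'E in e'.
Qed.

(** [b] splits [g a] into two parts of at most one vertex each. *)
Lemma palette_inj (G : digraph) (g : colouring k G) (a b : 'I_k) :
  g b \subset g a -> #|g b| <= 1 -> #|g a| <= #|g b|.+1 ->
  {in g a &, injective (palette g)}.
Proof.
move=> sba b1 a2 x x' xa x'a /setP/(_ b); rewrite !inE.
have : #|g a :\: g b| <= 1 by rewrite cardsDS // leq_subLR addn1.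
have [xb|xb] := boolP (x \in g b) => d1 /esym x'b.
  by move/card_le1_eqP: b1; apply.
by move/card_le1_eqP: d1; apply; rewrite inE ?xb ?x'b.
Qed.

Lemma win_small (G H : digraph) (g : colouring k G) (h : colouring k H)
    (a b : 'I_k) :
  a != b -> #|g a| <= 2 -> ~~ iso (induced (g a)) (induced (h a)) -> win g h.
Proof.
move=> ab g2 niso.
have [cgh|] := eqVneq #|g a| #|h a|; last exact: win_card ab.
have [B sB cB] := exists_subset_card (leq_pred #|g a|).
apply: (@win_step_l _ _ _ _ b B) => g' h' g'b g'E h'E nw.
have [c'|] := eqVneq #|g' b| #|h' b|; last first.
  by apply: (@win_card _ _ _ _ b a); rewrite 1?eq_sym.
have c1 : #|g' b| <= 1 by rewrite g'b cB; case: #|g a| g2 => [|[|[]]].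
case/negP: niso; rewrite -g'E // -h'E //; apply: not_won_iso => //.
  by apply: (@palette_inj _ _ _ b); rewrite ?(g'E a) // g'b // cB leqSpred.
apply: (@palette_inj _ _ _ b); rewrite -?c' //.
  apply/subsetP=> y yh; have [z yz] := not_won_vertex (not_won_sym nw) y.
  by rewrite yz g'E //; apply: (subsetP sB); rewrite -g'b -yz.
by rewrite h'E // -cgh g'b cB leqSpred.
Qed.

Lemma win_not_iso (G H : digraph) (g : colouring k G) (h : colouring k H)
    (a b c : 'I_k) :
  degree_associated_reconstruction -> a != b -> a != c -> b != c ->
  ~~ iso (induced (g a)) (induced (h a)) -> win g h.
Proof.
move=> rec; have [n] := ubnP #|g a|.
elim: n => // n IHn in G H g h a b c * => lt_n ab ac bc niso.
have [le2|gt2] := leqP #|g a| 2; first exact: win_small ab le2 niso.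
have [cgh|] := eqVneq #|g a| #|h a|; last exact: win_card ab.
have [|xy [F neF]] := rec _ _ niso; first by left; rewrite card_sig.
have {neF} : #|deleted (induced (g a)) xy F| != #|deleted (induced (h a)) xy F|.
  exact/eqP.
wlog lt : G H g h lt_n niso gt2 cgh /
    #|deleted (induced (h a)) xy F| < #|deleted (induced (g a)) xy F|.
  move=> IH ne; move: (ne); rewrite neq_ltn => /orP[lt|lt];
    last exact: IH lt ne.
  apply: win_sym; apply: IH lt _; rewrite -?cgh // 1?eq_sym //.
  by apply: contra niso => /iso_sym.
move=> _; set T := deleted (induced (h a)) _ _ in lt.
set S := deleted _ _ _ in lt.
have ba : b != a by rewrite eq_sym.
have ca : c != a by rewrite eq_sym.
have cb : c != b by rewrite eq_sym.
apply: (@win_step_l _ _ _ _ b (val @: S)) => g1 h1 g1b g1E h1E nw1.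
have [c1|] := eqVneq #|g1 b| #|h1 b|; last exact: win_card ba.
(* [h1 b] has the size of [S], which exceeds that of [T]. *)
have [v vb vT] : exists2 v, v \in h1 b & v \notin val @: T.
  apply/subsetPn; apply: contraTN lt => /subset_leq_card.
  by rewrite -c1 g1b !(card_imset _ val_inj) -leqNgt.
apply: (@win_step_r _ _ _ _ c [set v]) => g2 h2 h2c g2E h2E nw2.
have [c2|] := eqVneq #|g2 c| #|h2 c|; last exact: win_card ca.
have [u g2c] : exists u, g2 c = [set u].
  by apply/cards1P; rewrite c2 h2c cards1.
have uv : same_palette g2 h2 u v.
  have [z uz] := not_won_vertex nw2 u.
  by have := uz c; rewrite g2c h2c !inE eqxx => /esym/eqP<-.
have uS : u \in val @: S by rewrite -g1b -g2E // uv h2E.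
have g2a : g2 a = g a by rewrite g2E // g1E.
have h2a : h2 a = h a by rewrite h2E // h1E.
have [u' u'S uE] : exists2 u' : induced (g a), u' \in S & u = val u'.
  by case/imsetP: uS => u'; exists u'.
have va : v \in h a by rewrite -h2a -uv g2a uE (valP u').
pose v' : induced (h a) := Sub v va.
have v'T : v' \notin T by apply: contra vT => v'T; apply/imsetP; exists v'.
have [tE|] := eqVneq (tau u') (tau v'); last first.
  rewrite !tau_induced -uE xpair_eqE negb_and -[\val v']/v -g2a -h2a.
  by case/orP; apply: (win_degree ab ac bc).
(* As the degrees agree, [v'] can be outside [T] only because its card is not [F]. *)
move: u'S v'T; rewrite !inE -tE => /andP[-> isoF] /= nisoF.
(* As [c] singles out [u] and [v], palettes force the reply [h2 a :\ v]. *)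
apply: (@win_step_l _ _ _ _ b (g2 a :\ u)) => g3 h3 g3b g3E h3E nw3.
have h3b : h3 b = h2 a :\ v.
  apply/setP=> y; have [z yz] := not_won_vertex (not_won_sym nw3) y.
  rewrite yz g3b !in_setD1 -!in_set1 -g2c -h2c -!g3E // -!h3E //.
  by rewrite !yz.
apply: (IHn _ _ _ _ b a c) => //.
  move: lt_n; rewrite ltnS; apply: leq_trans.
  by rewrite g3b g2a [ltnRHS](cardsD1 u) uE (valP u').
rewrite g3b h3b g2a h2a; apply: contra nisoF => iso_uv.
apply: iso_trans isoF; apply: iso_trans (del_vertex_induced v') _.
apply: iso_sym; apply: iso_trans iso_uv.
by rewrite uE; apply: del_vertex_induced.
Qed.

End Game.

Theorem theorem8p2 :
  degree_associated_reconstruction ->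
  forall G H : digraph, ~~ iso G H -> forall_has_winning_strategy 3 G H.
Proof.
move=> rec G H niso.
suff /(@win_wins_from 3 G H _ _ isT)[s sP] :
    @win 3 G H [ffun=> set0] [ffun=> set0].
  by exists s => q [q0 qP]; apply: sP.
pose a : 'I_3 := inord 0; pose b : 'I_3 := inord 1; pose c : 'I_3 := inord 2.
have [ab ac bc] : [/\ a != b, a != c & b != c] by rewrite -!val_eqE /= !inordK.
(* The reply must also be everything, since a vertex without [a] would have no counterpart. *)
apply: (@win_step_l _ _ _ _ _ a setT) => g h ga _ _ nw.
have ha : h a = setT.
  apply/setP=> y; have [x yx] := not_won_vertex (not_won_sym nw) y.
  by rewrite yx ga !inE.
apply: (win_not_iso rec ab ac bc); rewrite ga ha; apply: contra niso => isoT.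
apply: iso_trans (iso_induced_setT G) (iso_trans isoT _).
exact: iso_sym (iso_induced_setT H).
Qed.
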